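(* Let $G$ be a connected graph with at least two vertices. Then \[ C(\pi)\ \ge\ \tfrac12 M . \]
   Context: $G$ is a finite connected undirected graph (loops and multiple edges are allowed) with vertex set $V$. The walk considered is the usual simple random walk on $G$ (at each step, move along a uniformly chosen edge incident with the current vertex); $\pi$ is its stationary distribution, $\pi_i$ proportional to the degree of $i$. For $i\in V$, $C(i)$ is the expected number of steps a random walk starting from $i$ takes until it has visited all vertices of $G$, and $C(\pi)=\sum_{i\in V}\pi_iC(i)$ is the cover time when the walk is started from a random vertex chosen from $\pi$. $H(i,j)$ is the expected number of steps a walk started at $i$ needs to reach $j$, and $\kappa(i,j)=H(i,j)+H(j,i)$ is the commute time. For $S\subseteq V$ with $|S|\ge 2$ let $\kappa_S=\min_{i,j\in S,\,i\ne j}\kappa(i,j)$, and \[ M=\max_{S\subseteq V,\ |S|\ge 2}\kappa_S\ln|S| . \] *)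

(* Defs.v *)
From mathcomp Require Import all_boot all_order all_algebra.
From mathcomp Require Import all_classical all_reals all_analysis.

Set Implicit Arguments.
Unset Strict Implicit.
Unset Printing Implicit Defensive.

Import Order.TTheory GRing.Theory Num.Theory.

Local Open Scope classical_set_scope.
Local Open Scope ring_scope.

(* A finite undirected multigraph, given by its edge multiplicities: for i != j,
   [mult i j] is the number of edges joining i and j, and [mult i i] is the
   total contribution of the loops at i to the degree of i. Nothing is assumed
   about [mult i i], so both conventions for loops (each loop counted once or
   twice in the degree) are instances. *)
Record multigraph := Multigraph {
  vertex :> finType;
  mult : vertex -> vertex -> nat;
  multC : forall i j, mult i j = mult j i
}.

Section Graph.
Variable G : multigraph.

Definition adj : rel G := fun i j => (0 < mult i j)%N.

Definition connected_graph : Prop := forall i j : G, connect adj i j.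

Definition degree (i : G) : nat := (\sum_(j : G) mult i j)%N.

Variable R : realType.

Definition step_prob (i j : G) : R := (mult i j)%:R / (degree i)%:R.

Definition stationary (i : G) : R :=
  (degree i)%:R / (\sum_(j : G) degree j)%:R.

Variables (d : measure_display) (T : measurableType d).

Definition follows (X : nat -> T -> G) (x : nat -> G) (n : nat) : set T :=
  [set w | forall k, (k <= n)%N -> X k w = x k].

(* Under [P i] the process X is the simple random walk on G started at i: given
   X 0 = x 0, ..., X n = x n, the next vertex is x n.+1 with conditional
   probability [step_prob (x n) (x n.+1)]. The conditional probability is
   multiplied out, so that nothing is required of paths of probability 0. *)
Record simple_random_walk (P : G -> probability T R) (X : nat -> T -> G) :
    Prop := SimpleRandomWalk {
  srw_measurable : forall n v, measurable (X n @^-1` [set v]);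
  srw_start : forall i, P i (X 0%N @^-1` [set i]) = 1%E;
  srw_step : forall i (x : nat -> G) n,
    P i (follows X x n.+1) =
      (P i (follows X x n) * (step_prob (x n) (x n.+1))%:E)%E
}.

(* Both times are +oo when the event never happens, as ereal_inf set0 = +oo. *)
Definition hitting_time (X : nat -> T -> G) (j : G) (w : T) : \bar R :=
  ereal_inf [set n%:R%:E | n in [set n : nat | X n w = j]].

Definition covering_time (X : nat -> T -> G) (w : T) : \bar R :=
  ereal_inf [set n%:R%:E | n in
    [set n : nat | forall v, exists2 k, (k <= n)%N & X k w = v]].

Variables (P : G -> probability T R) (X : nat -> T -> G).

Definition expected_hitting (i j : G) : \bar R :=
  (\int[P i]_w hitting_time X j w)%E.

Definition expected_cover (i : G) : \bar R :=
  (\int[P i]_w covering_time X w)%E.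

Definition stationary_cover : \bar R :=
  (\sum_(i : G) (stationary i)%:E * expected_cover i)%E.

Definition commute_time (i j : G) : \bar R :=
  (expected_hitting i j + expected_hitting j i)%E.

Definition min_commute (S : {set G}) : \bar R :=
  \big[Order.min/+oo%E]_(i in S)
    \big[Order.min/+oo%E]_(j in S | i != j) commute_time i j.

Definition matthews_max : \bar R :=
  \big[Order.max/-oo%E]_(S : {set G} | (2 <= #|S|)%N)
    (min_commute S * (ln #|S|%:R)%:E)%E.

End Graph.

(* Main.v *)
(* Let H(i,j) be the expected hitting times and f(j) = sum_i pi_i H(i,j).
   Reversibility, in the form of the symmetry of the Laplacian energy form E,
   gives f(i) - H(j,i) = f(j) - H(i,j), and E(H(.,i) + H(.,j)) >= 0 gives
   kappa(i,j) <= 2 (f(i) + f(j)).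

   Matthews' argument visits S in uniformly random order: the expected time
   added by the k-th vertex, when it is reached after the k-1 preceding ones, is
   H(x,y) = (kappa(x,y) + f(y) - f(x)) / 2, where x and y are the last vertices
   reached before and after it is added. The differences of f telescope, so from
   pi the expected time to cover S, with n = |S| and h_n the harmonic sum, is at
   least
     (avg_S f + min_S f + kappa_S (h_n - 1)) / 2,
   and the pairwise bound on f together with h_n >= ln n + 1/2 + 1/(2n) makes
   this at least kappa_S (ln n) / 2.

   No random order and no stopping time is needed: averaging over the order
   gives an explicit function of the current vertex and of the set still to be
   visited, whose one-step expected decrease is at most 1 until everything is
   covered, and such a function bounds the expected cover time from below. *)

Require Import Defs.
From HB Require Import structures.
From mathcomp Require Import all_boot all_order all_algebra.
From mathcomp Require Import all_classical all_reals all_analysis.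
From mathcomp Require Import measurable_realfun ring lra.

Set Implicit Arguments.
Unset Strict Implicit.
Unset Printing Implicit Defensive.

Import Order.TTheory GRing.Theory Num.Theory.
Import numFieldNormedType.Exports.

Local Open Scope classical_set_scope.
Local Open Scope ring_scope.

(** * Comparison of the logarithm with harmonic sums *)

Section Harmonic.
Context {R : realType}.
Implicit Types (x y : R) (n : nat).

Lemma expR_ge_quadratic y : 0 <= y -> 1 + y + y ^+ 2 / 2 <= expR y.
Proof.
move=> y0; have -> : 1 + y + y ^+ 2 / 2 = series (exp_coeff y) 3.
  rewrite /series /= !big_nat_recr //= big_geq // /exp_coeff /=.
  by rewrite add0r !expr0 expr1 !fact0 divr1 factS fact0 divr1.
apply: nondecreasing_cvgn_le; last exact: is_cvg_series_exp_coeff.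
apply/nondecreasing_seqP => n; rewrite /series /= big_nat_recr //= lerDl.
by rewrite exp_coeff_ge0.
Qed.

(** With e = e^y, multiplication by e turns the claim into (e - y)^2 >= 1 + y^2, which follows from
    e - y >= 1 + y^2/2. *)
Lemma double_le_expRB y : 0 <= y -> y *+ 2 <= expR y - expR (- y).
Proof.
move=> y0; have e0 := expR_gt0 y.
have := expR_ge_quadratic y0; rewrite expRN.
set e := expR y in e0 *; move=> he.
rewrite -(ler_pM2r e0) mulrBl mulVf ?gt_eqF// mulr2n.
nra.
Qed.

(* With 1 + 1/n = e^y this is y <= sinh y, i.e. the trapezoidal bound for the
   integral of 1/x over [n, n+1]. *)
Lemma ln_succ_sub_le n : (0 < n)%N ->
  ln n.+1%:R - ln n%:R <= (n%:R^-1 + n.+1%:R^-1) / 2 :> R.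
Proof.
move=> n0; have n0' : 0 < n%:R :> R by rewrite ltr0n.
have n1' : 0 < n.+1%:R :> R by rewrite ltr0n.
rewrite -ln_div ?posrE//; set y := ln _.
have q0 : 0 < n.+1%:R / n%:R :> R by rewrite divr_gt0.
have y0 : 0 <= y by rewrite ln_ge0// ler_pdivlMr// mul1r ler_nat.
have := double_le_expRB y0; rewrite expRN /y lnK ?posrE// invf_div mulr2n.
have -> : n.+1%:R / n%:R - n%:R / n.+1%:R = n%:R^-1 + n.+1%:R^-1 :> R.
  by rewrite -(natr1 n) in n1' *; field; rewrite !gt_eqF.
by rewrite ler_pdivlMr// mulr_natr mulr2n.
Qed.

Definition harmonic_sum n : R := \sum_(0 <= k < n) k.+1%:R^-1.

Lemma harmonic_sumS n : harmonic_sum n.+1 = harmonic_sum n + n.+1%:R^-1.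
Proof. by rewrite /harmonic_sum big_nat_recr. Qed.

Lemma harmonic_sum1 : harmonic_sum 1 = 1.
Proof. by rewrite /harmonic_sum big_nat1 invr1. Qed.

Lemma ln_le_harmonic_sum n : (0 < n)%N ->
  ln n%:R + 2^-1 + (n%:R * 2)^-1 <= harmonic_sum n.
Proof.
(* Equality holds at n = 1; the term 1/(2n) turns the trapezoidal bound into an increment of at most
   1/(n+1). *)
case: n => // n _; elim: n => [|n IH].
  by rewrite harmonic_sum1 ln1 mul1r; lra.
rewrite harmonic_sumS; have := @ln_succ_sub_le n.+1 isT.
move: IH; rewrite !invfM.
move: (n.+1%:R^-1) (n.+2%:R^-1) (ln n.+1%:R) (ln n.+2%:R) (harmonic_sum _) => *; lra.
Qed.

End Harmonic.

(** * The graph Laplacian and its energy form *)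

Section Laplacian.
Context {R : realType} {G : multigraph}.
Implicit Types (u v : G -> R) (x y : G).

Definition laplacian v x : R := \sum_y (mult x y)%:R * (v x - v y).

Definition energy u v : R := \sum_x u x * laplacian v x.

(** Summation by parts: averaging over the two orientations of each edge makes symmetry and
    positivity visible. *)
Lemma energyE u v :
  energy u v *+ 2 = \sum_x \sum_y (mult x y)%:R * ((u x - u y) * (v x - v y)).
Proof.
have e1 : energy u v = \sum_x \sum_y (mult x y)%:R * (u x * (v x - v y)).
  apply: eq_bigr => x _; rewrite mulr_sumr; apply: eq_bigr => y _.
  by rewrite mulrCA.
rewrite mulr2n {2}e1 exchange_big/= e1 -big_split; apply: eq_bigr => x _ /=.
rewrite -big_split; apply: eq_bigr => y _ /=; rewrite (multC y x); ring.
Qed.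

Lemma energyC u v : energy u v = energy v u.
Proof.
suff : energy u v *+ 2 = energy v u *+ 2 by lra.
rewrite !energyE; apply: eq_bigr => x _; apply: eq_bigr => y _.
by rewrite [_ * (v x - v y)]mulrC.
Qed.

Lemma energy_ge0 u : 0 <= energy u u.
Proof.
rewrite -(@pmulrn_lge0 _ _ 2)// energyE.
by apply: sumr_ge0 => x _; apply: sumr_ge0 => y _; rewrite mulr_ge0// -expr2 sqr_ge0.
Qed.

Lemma laplacian_lin a b u v x :
  laplacian (fun y => a * u y + b * v y) x = a * laplacian u x + b * laplacian v x.
Proof.
rewrite /laplacian !mulr_sumr -big_split; apply: eq_bigr => y _ /=; ring.
Qed.

Lemma energyD u v :
  energy (fun x => u x + v x) (fun x => u x + v x) =
  energy u u + energy v v + energy u v *+ 2.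
Proof.
rewrite mulr2n {2}energyC /energy -!big_split; apply: eq_bigr => x _ /=.
have -> : laplacian (fun y => u y + v y) x = laplacian u x + laplacian v x.
  by rewrite /laplacian -big_split; apply: eq_bigr => y _ /=; ring.
ring.
Qed.

Lemma sum_laplacian v : \sum_x laplacian v x = 0.
Proof.
have -> : \sum_x laplacian v x = energy (fun=> 1) v.
  by apply: eq_bigr => x _; rewrite mul1r.
rewrite energyC /energy big1// => x _.
by rewrite /laplacian big1 ?mulr0// => y _; rewrite subrr mulr0.
Qed.

(** Every term of a vanishing sum of squares vanishes, so [u] agrees across each edge and then along
    paths. *)
Lemma energy_eq0 u : connected_graph G -> energy u u = 0 -> forall x y, u x = u y.
Proof.
move=> connG u0 x y.
have adj_eq a b : adj a b -> u a = u b.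
  move=> ab; move: (energyE u u); rewrite u0 mul0rn => /esym/eqP.
  rewrite psumr_eq0; last first.
    by move=> c _; apply: sumr_ge0 => d _; rewrite mulr_ge0// -expr2 sqr_ge0.
  move=> /allP/(_ a); rewrite mem_index_enum => /(_ isT)/=.
  rewrite psumr_eq0; last by move=> d _; rewrite mulr_ge0// -expr2 sqr_ge0.
  move=> /allP/(_ b); rewrite mem_index_enum => /(_ isT)/=.
  rewrite -expr2 mulf_eq0 sqrf_eq0 pnatr_eq0 subr_eq0 => /orP[/eqP m0|/eqP//].
  by move: ab; rewrite /adj m0.
have /connectP[p] := connG x y.
elim: p x => [x _ ->//|a p IH x /= /andP[/adj_eq -> pa] yl]; exact: IH.
Qed.

End Laplacian.

(** * Hitting times as solutions of linear equations *)

Section HittingPotential.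
Context {R : realType} {G : multigraph}.
Hypotheses (connG : connected_graph G) (G_ge2 : (2 <= #|G|)%N).
Implicit Types (u v : G -> R) (x y i j : G).

Lemma degree_gt0 x : (0 < degree x)%N.
Proof.
have [y yx] : exists y, y != x.
  case/card_gt1P: G_ge2 => a [b [_ _ ab]].
  by have [xa|] := eqVneq a x; [exists b; rewrite -xa eq_sym | exists a].
have /connectP[[|a p] /= pth yl] := connG x y; first by rewrite yl eqxx in yx.
case/andP: pth => xa _.
by rewrite /degree (bigD1 a)//= addn_gt0 (xa : (0 < mult x a)%N).
Qed.

Lemma degree_neq0 x : (degree x)%:R != 0 :> R.
Proof. by rewrite pnatr_eq0 -lt0n degree_gt0. Qed.

Let D : R := (\sum_(x : G) degree x)%:R.

Lemma total_degree_gt0 : 0 < D.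
Proof.
have /card_gt0P[x _] : (0 < #|G|)%N by apply: leq_trans G_ge2.
by rewrite /D ltr0n (bigD1 x)//= addn_gt0 degree_gt0.
Qed.

Lemma step_prob_ge0 x y : 0 <= step_prob R x y.
Proof. exact: divr_ge0. Qed.

Lemma sum_step_prob x : \sum_y step_prob R x y = 1.
Proof. by rewrite -mulr_suml -natr_sum divff// degree_neq0. Qed.

Lemma laplacian_step v x :
  laplacian v x = (degree x)%:R * (v x - \sum_y step_prob R x y * v y).
Proof.
rewrite -[v x in RHS]mul1r -[X in X * v x](sum_step_prob x) mulr_suml -sumrB mulr_sumr.
apply: eq_bigr => y _; rewrite -mulrBr mulrA /step_prob; congr (_ * _).
by rewrite mulrCA divff ?mulr1// degree_neq0.
Qed.

Definition hitting_eqns j (v : G -> R) : Prop :=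
  v j = 0 /\ forall x, x != j -> v x = 1 + \sum_y step_prob R x y * v y.

Lemma hitting_eqns_exist j : exists v, hitting_eqns j v.
Proof.
(* Up to multiplication by degrees, [f] is the operator of the system; in finite dimension its
   injectivity gives a solution. *)
pose f (v : {ffun G -> R^o}) : {ffun G -> R^o} :=
  [ffun x => if x == j then v j else laplacian v x].
have f_lin : linear f.
  move=> a u v; apply/ffunP => x; rewrite !ffunE.
  case: ifP => _ //; rewrite -[laplacian v x]mul1r -laplacian_lin.
  by apply: eq_bigr => y _; rewrite !ffunE !mul1r.
pose fL := GRing.isLinear.Build _ _ _ _ f f_lin.
pose F : {linear {ffun G -> R^o} -> {ffun G -> R^o}} := HB.pack f fL.
have ker0 : lker (linfun F) == 0%VS.
  rewrite -subv0; apply/subvP => v; rewrite memv_ker memv0 lfunE /= => /eqP f0.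
  have f0x x : f v x = 0 by rewrite f0 ffunE.
  have vj : v j = 0 by have := f0x j; rewrite ffunE eqxx.
  apply/eqP/ffunP => x; rewrite ffunE -vj.
  (* A kernel element vanishes at [j] and is harmonic elsewhere, so it has zero energy and is
     constant. *)
  apply: energy_eq0 => //; rewrite /energy big1// => y _.
  have [->|yj] := eqVneq y j; first by rewrite vj mul0r.
  by have := f0x y; rewrite ffunE (negPf yj) => ->; rewrite mulr0.
pose b : {ffun G -> R^o} := [ffun x => if x == j then 0 else (degree x)%:R].
have := lker0_lfunVK ker0 b; set v := (_^-1)%VF _; rewrite lfunE /= => fv.
have fvx x : f v x = b x by rewrite fv.
exists v; split; first by have := fvx j; rewrite !ffunE eqxx.
move=> x xj; have := fvx x; rewrite !ffunE (negPf xj) laplacian_step.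
rewrite -[RHS]mulr1 => /(mulfI (degree_neq0 x)) /eqP.
by rewrite subr_eq => /eqP.
Qed.

(* [hit j x] stands for H(x, j): the target comes first. *)
Definition hit j : G -> R := projT1 (cid (hitting_eqns_exist j)).

Lemma hit_eqns j : hitting_eqns j (hit j).
Proof. exact: projT2 (cid (hitting_eqns_exist j)). Qed.

Lemma hit_self j : hit j j = 0.
Proof. by case: (hit_eqns j). Qed.

Lemma hit_step j x : x != j -> hit j x = 1 + \sum_y step_prob R x y * hit j y.
Proof. by case: (hit_eqns j) => _; apply. Qed.

(** Minimum principle: at a minimum outside [j], the value would exceed by 1 an average of values at
    least as large. *)
Lemma hit_ge0 j x : 0 <= hit j x.
Proof.
case: (@arg_minP _ _ G j xpredT (hit j) isT) => y _ ymin.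
apply: le_trans (ymin x isT).
have [->|yj] := eqVneq y j; first by rewrite hit_self.
have : 1 + hit j y <= hit j y.
  rewrite [leRHS]hit_step// lerD2l -[leLHS]mul1r -[X in X * _](sum_step_prob y) mulr_suml.
  by apply: ler_sum => z _; rewrite ler_wpM2l ?step_prob_ge0 ?ymin.
by rewrite gerDr ler10.
Qed.

(** Away from [j] this is the hitting equation; the value at [j] is forced because a Laplacian sums
    to 0. *)
Lemma laplacian_hit j x : laplacian (hit j) x = (degree x)%:R - (if x == j then D else 0).
Proof.
have off y : y != j -> laplacian (hit j) y = (degree y)%:R.
  by move=> yj; rewrite laplacian_step (hit_step yj) addrK mulr1.
case: ifPn => [/eqP->|/off ->]; last by rewrite subr0.
have := sum_laplacian (hit j); rewrite (bigD1 j)//= (eq_bigr (fun y => (degree y)%:R)).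
  move=> /eqP; rewrite addr_eq0 => /eqP ->.
  rewrite /D natr_sum [in RHS](bigD1 j)//=; ring.
by move=> y; exact: off.
Qed.

Definition mean_hit j : R := \sum_x stationary R x * hit j x.

Lemma mean_hit_ge0 j : 0 <= mean_hit j.
Proof. by apply: sumr_ge0 => x _; rewrite mulr_ge0 ?hit_ge0// divr_ge0. Qed.

Lemma energy_hit i j : energy (hit i) (hit j) = D * (mean_hit i - hit i j).
Proof.
rewrite /energy (eq_bigr (fun x => D * (stationary R x * hit i x) -
    (if x == j then D * hit i j else 0))); last first.
  move=> x _; rewrite laplacian_hit mulrBr /stationary; congr (_ - _).
    by rewrite -/D mulrA [D * _]mulrC divfK ?gt_eqF ?total_degree_gt0// mulrC.
  by case: eqP => [->|_]; rewrite ?mulr0// mulrC.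
rewrite sumrB -mulr_sumr -/(mean_hit i) -big_mkcond big_pred1_eq mulrBr//.
Qed.

Lemma hit_symm i j : mean_hit i - hit i j = mean_hit j - hit j i.
Proof.
have := energyC (hit i) (hit j); rewrite !energy_hit => /mulfI; apply.
by rewrite gt_eqF// total_degree_gt0.
Qed.

(* In the energy seminorm, up to the total degree, [mean_hit i] is the square of
   [hit i] and the commute time is the square of [hit i - hit j], so this is the
   parallelogram law. *)
Lemma commute_le_mean_hit i j : hit i j + hit j i <= 2 * (mean_hit i + mean_hit j).
Proof.
have := energy_ge0 (fun x => hit i x + hit j x).
rewrite energyD !energy_hit !hit_self !subr0 -mulrnAr -!mulrDr.
rewrite pmulr_rge0 ?total_degree_gt0//; have := hit_symm i j; lra.
Qed.

End HittingPotential.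

(** Tail-sum formula: a first occurrence time counts the n up to which nothing has occurred,
    including when it is infinite. *)
Lemma ereal_inf_nat_series {R : realType} (D : set nat) (b : nat -> bool) :
  (forall n, b n <-> forall k, (k <= n)%N -> ~ D k) ->
  ereal_inf [set n%:R%:E | n in D] = (\sum_(n <oo) (b n)%:R%:E)%E :> \bar R.
Proof.
move=> bD; have b0 n : (0 <= (b n)%:R%:E :> \bar R)%E by rewrite lee_fin.
have [[n0 Dn0]|noD] := pselect (exists n, D n).
  have ex : exists n, `[< D n >] by exists n0; apply/asboolP.
  case: (ex_minnP ex) => m /asboolP Dm mmin.
  have bE n : b n = (n < m)%N.
    apply/idP/idP => [/bD bn|nm].
      by rewrite ltnNge; apply/negP => mn; exact: (bn m).
    apply/bD => k kn /asboolP/mmin mk.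
    by move: (leq_ltn_trans kn nm); rewrite ltnNge mk.
  rewrite (nneseries_split 0 m)//= add0n eseries0 ?adde0; last first.
    by move=> k mk _; rewrite bE ltnNge mk.
  rewrite (eq_big_nat _ _ (F2 := fun=> 1%:E)); last by move=> k /= km; rewrite bE km.
  rewrite sumEFin sumr_const_nat subn0.
  apply/eqP; rewrite eq_le; apply/andP; split.
    by apply: ereal_inf_lbound; exists m.
  apply: le_ereal_inf_tmp => _ [n Dn <-]; rewrite lee_fin ler_nat; apply: mmin; exact/asboolP.
have bT n : b n by apply/bD => k _ Dk; apply: noD; exists k.
rewrite (_ : [set _ | _ in _] = set0); last first.
  by apply/seteqP; split=> // x [n Dn _]; apply: noD; exists n.
rewrite ereal_inf0; apply/esym/eqyP => A A0.
apply: (@le_trans _ _ (\sum_(0 <= n < Num.bound A) (b n)%:R%:E)%E); last exact: nneseries_lim_ge.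
rewrite (eq_bigr (fun=> 1%:E)); last by move=> k _; rewrite bT.
rewrite sumEFin sumr_const_nat subn0 lee_fin.
exact: ltW (archi_boundP (ltW A0)).
Qed.

(** * Measurability and partitions for finite-valued maps *)

Section FiniteValued.
Context {d : measure_display} {T : measurableType d} {R : realType} {I : finType}.
Variables (g : T -> I) (mg : forall i, measurable (g @^-1` [set i])).

Lemma measurable_preimage_fin (A : set I) : measurable (g @^-1` A).
Proof.
rewrite (_ : g @^-1` A = \bigcup_(i in A) g @^-1` [set i]); last first.
  by apply/seteqP; split=> [w Agw|w [i Ai /= ->]//]; exists (g w).
by apply: fin_bigcup_measurable => // i _.
Qed.

Lemma measure_partition_fin (mu : {measure set T -> \bar R}) (B : set T) :
  measurable B -> mu B = (\sum_i mu (B `&` g @^-1` [set i]))%E.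
Proof.
move=> mB; have {1}-> : B = \bigcup_(i in [set: I]) (B `&` g @^-1` [set i]).
  by rewrite -setI_bigcupr; apply/seteqP; split=> [w Bw|w []//]; split=> //; exists (g w).
rewrite measure_fin_bigcup; first 1 last.
- exact: finite_finset.
- by move=> i j _ _ [w [[_ <-] [_ <-]]].
- by move=> i _; exact: measurableI.
rewrite (@bigfs _ _ _ _ (index_enum I) xpredT) ?index_enum_uniq//; last first.
  by move=> i _; rewrite mem_index_enum.
by apply: eq_fsbigl; apply/seteqP.
Qed.

End FiniteValued.

(** * The Markov chain of current vertex and visited set *)

Section VisitedChain.
Context {R : realType} {G : multigraph}.
Context {d : measure_display} {T : measurableType d}.
Variables (P : G -> probability T R) (X : nat -> T -> G).
Hypothesis walkX : simple_random_walk P X.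
Implicit Types (n : nat) (i : G) (z : G * {set G}) (F : G * {set G} -> R).

(** The trajectory up to time n takes finitely many values and determines the state; its level sets
    are the events [follows] of the walk's definition. *)
Let path n (w : T) : {ffun 'I_n.+1 -> G} := [ffun k => X (val k) w].

Lemma preimage_path n (f : {ffun 'I_n.+1 -> G}) :
  path n @^-1` [set f] = follows X (fun k => f (inord k)) n.
Proof.
apply/seteqP; split=> [w <- k kn|w fw]; first by rewrite ffunE /= inordK.
by apply/ffunP => k; rewrite ffunE fw ?leq_ord// inord_val.
Qed.

Lemma measurable_follows x n : measurable (follows X x n).
Proof.
rewrite (_ : follows X x n = \bigcap_(k in `I_n.+1) (X k @^-1` [set x k])).
  by apply: fin_bigcap_measurable => // k _; exact: (srw_measurable walkX).
by apply/seteqP; split.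
Qed.

Let measurable_path n f : measurable (path n @^-1` [set f]).
Proof. by rewrite preimage_path; exact: measurable_follows. Qed.

(* The vertices visited strictly before time n: the current vertex is left out,
   so that every pair in [G * {set G}] is a sensible state. *)
Definition visited n (w : T) : {set G} := (\bigcup_(k < n) [set X k w])%SET.

Definition state n (w : T) : G * {set G} := (X n w, visited n w).

Lemma visitedS n w : visited n.+1 w = (X n w |: visited n w)%SET.
Proof. by rewrite /visited big_ord_recr /= finset.setUC. Qed.

Lemma visitedP n w v : reflect (exists2 k, (k < n)%N & X k w = v) (v \in visited n w).
Proof.
apply: (iffP bigcupP) => [[k _ /set1P ->]|[k kn <-]]; first by exists k.
by exists (Ordinal kn) => //; rewrite inE.
Qed.

Let state_of n (f : {ffun 'I_n.+1 -> G}) : G * {set G} :=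
  (f ord_max, (\bigcup_(k < n) [set f (widen_ord (leqnSn n) k)])%SET).

Let state_path n w : state n w = state_of (path n w).
Proof.
by rewrite /state /state_of ffunE; congr pair; apply: eq_bigr => k _; rewrite ffunE.
Qed.

Lemma measurable_state n z : measurable (state n @^-1` [set z]).
Proof.
rewrite (_ : _ @^-1` _ = path n @^-1` [set f | state_of f = z]).
  exact: (measurable_preimage_fin (@measurable_path n)).
by apply/seteqP; split=> w /=; rewrite state_path.
Qed.

Lemma markov i n z v :
  P i (state n @^-1` [set z] `&` X n.+1 @^-1` [set v]) =
  (P i (state n @^-1` [set z]) * (step_prob R z.1 v)%:E)%E.
Proof.
have mz := measurable_state n z.
rewrite (measure_partition_fin (@measurable_path n)); last first.
  by apply: measurableI => //; exact: (srw_measurable walkX).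
rewrite [in RHS](measure_partition_fin (@measurable_path n))// ge0_sume_distrl//.
apply: eq_bigr => f _; have [fz|fz] := eqVneq (state_of f) z; last first.
  have e0 (A : set T) : A `<=` state n @^-1` [set z] -> A `&` path n @^-1` [set f] = set0.
    move=> Az; apply/seteqP; split => // w [/Az /= wz wf].
    by move: fz; rewrite -wz state_path wf eqxx.
  by rewrite !e0 ?measure0 ?mul0e// => w [].
(* Extending [f] by [v] at time n+1 lets one sequence describe both events. *)
pose x k := if (k <= n)%N then f (inord k) else v.
have -> : state n @^-1` [set z] `&` path n @^-1` [set f] = follows X x n.
  rewrite preimage_path; apply/seteqP; split=> [w [_ fw] k kn|w fw].
    by rewrite /x kn fw.
  split; last by move=> k kn; rewrite fw// /x kn.
  rewrite /= state_path -fz; congr state_of; apply/ffunP => k.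
  by rewrite ffunE fw ?leq_ord// /x leq_ord inord_val.
have -> : state n @^-1` [set z] `&` X n.+1 @^-1` [set v] `&` path n @^-1` [set f] =
    follows X x n.+1.
  rewrite preimage_path; apply/seteqP; split=> [w [[_ /= wv] fw] k|w fw].
    by rewrite leq_eqVlt => /predU1P[->|kn]; rewrite /x ?ltnn// -ltnS kn fw.
  have fw' : follows X (fun k => f (inord k)) n w.
    by move=> k kn; rewrite fw ?leqW// /x kn.
  split=> //; split; last by rewrite /= fw// /x ltnn.
  rewrite /= state_path -fz; congr state_of; apply/ffunP => k.
  by rewrite ffunE fw' ?leq_ord// inord_val.
etransitivity; [exact: (srw_step walkX i x n)|]; congr (_ * (step_prob R _ _)%:E)%E.
  by rewrite /x leqnn -fz; congr (f _); apply/val_inj; rewrite /= inordK.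
by rewrite /x ltnn.
Qed.

Let law i n z : R := fine (P i (state n @^-1` [set z])).

Let lawE i n z : (law i n z)%:E = P i (state n @^-1` [set z]).
Proof. by rewrite fineK// fin_num_measure//; exact: measurable_state. Qed.

Let law_ge0 i n z : 0 <= law i n z.
Proof. by rewrite -lee_fin lawE. Qed.

Definition mean_state i n F : R := \sum_z law i n z * F z.

(** One-step operator of the chain: the vertex being left joins the visited set. *)
Definition transition F z : R :=
  \sum_v step_prob R z.1 v * F (v, z.1 |: z.2)%SET.

Lemma mean_state_le i n F F' : (forall z, F z <= F' z) -> mean_state i n F <= mean_state i n F'.
Proof. by move=> FF'; apply: ler_sum => z _; rewrite ler_wpM2l. Qed.

Lemma mean_state_ge0 i n F : (forall z, 0 <= F z) -> 0 <= mean_state i n F.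
Proof. by move=> F0; apply: sumr_ge0 => z _; rewrite mulr_ge0. Qed.

Lemma mean_stateD i n F F' :
  mean_state i n (fun z => F z + F' z) = mean_state i n F + mean_state i n F'.
Proof. by rewrite -big_split; apply: eq_bigr => z _ /=; rewrite mulrDr. Qed.

Lemma mean_stateZ i n a F : mean_state i n (fun z => a * F z) = a * mean_state i n F.
Proof. by rewrite /mean_state mulr_sumr; apply: eq_bigr => z _ /=; rewrite mulrCA. Qed.

Lemma mean_stateS i n F : mean_state i n.+1 F = mean_state i n (transition F).
Proof.
have lawS z' : law i n.+1 z' =
    \sum_z law i n z * (step_prob R z.1 z'.1 * (z'.2 == z.1 |: z.2)%:R)%SET.
  apply: EFin_inj; rewrite lawE -sumEFin.
  rewrite (measure_partition_fin (measurable_state n)); last exact: measurable_state.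
  apply: eq_bigr => z _; rewrite mulrA !EFinM lawE -markov.
  case: eqP => [z'E|z'E]; rewrite ?mule1 ?mule0.
    congr (P i _); apply/seteqP; split => [w [/= wz' wz]|w [/= wz wz']].
      by split=> //; rewrite -wz'.
    split=> //=; rewrite /state visitedS wz' [RHS]surjective_pairing z'E.
    by rewrite -wz.
  rewrite -[RHS](measure0 (P i)); congr (P i _); apply/seteqP; split => // w [/= wz' wz].
  by apply: z'E; rewrite -wz' -wz /= visitedS.
rewrite /mean_state (eq_bigr _ (fun z' _ => congr1 (fun t => t * F z') (lawS z'))).
under eq_bigr do rewrite mulr_suml.
rewrite exchange_big; apply: eq_bigr => z _ /=.
under eq_bigr do rewrite -!mulrA; rewrite -mulr_sumr; congr (_ * _).
have -> : transition F z = \sum_a \sum_b step_prob R z.1 a *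
    ((b == z.1 |: z.2)%SET%:R * F (a, b)).
  apply: eq_bigr => a _; rewrite (bigD1 (z.1 |: z.2)%SET)//= eqxx mul1r.
  by rewrite big1 ?addr0// => b /negPf ->; rewrite mul0r mulr0.
by rewrite pair_bigA; apply: eq_bigr => -[a b] _ /=; rewrite mulrA.
Qed.

Lemma mean_state0 i F : mean_state i 0 F = F (i, finset.set0).
Proof.
have s0 w : state 0 w = (X 0%N w, finset.set0) by rewrite /state /visited big_ord0.
have law1 : law i 0 (i, finset.set0) = 1.
  apply: EFin_inj; rewrite lawE -(srw_start walkX i); congr (P i _).
  by apply/seteqP; split=> w /=; rewrite s0; [case | move=> ->].
(* The point (i, set0) already carries the total mass 1. *)
have law0 z : z != (i, finset.set0) -> law i 0 z = 0.
  have : \sum_z law i 0 z = 1.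
    apply: EFin_inj; rewrite -sumEFin -[RHS](@probability_setT _ _ _ (P i)).
    rewrite (measure_partition_fin (measurable_state 0))//.
    by apply: eq_bigr => z' _; rewrite lawE setTI.
  rewrite (bigD1 (i, finset.set0))//= law1 => /eqP; rewrite -subr_eq0 addrAC subrr add0r.
  rewrite psumr_eq0// => /allP h zi; apply/eqP.
  by have := h z; rewrite mem_index_enum zi => /(_ isT).
rewrite /mean_state (bigD1 (i, finset.set0))//= law1 mul1r big1 ?addr0// => z /law0 ->.
by rewrite mul0r.
Qed.

Lemma integral_counting_states i (A : pred (G * {set G})) (tau : T -> \bar R) :
  (forall w, tau w = \sum_(n <oo) (A (state n w))%:R%:E)%E ->
  (\int[P i]_w tau w = \sum_(n <oo) (mean_state i n (fun z => (A z)%:R))%:E)%E.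
Proof.
move=> tauE; pose E n : set T := state n @^-1` [set z | A z].
have mE n : measurable (E n) by apply: (measurable_preimage_fin (measurable_state n)).
have EE n w : ((A (state n w))%:R : R) = \1_(E n) w.
  by rewrite indicE; congr (_ %:R); congr nat_of_bool; apply/idP/idP; rewrite inE.
under eq_integral do rewrite tauE.
rewrite integral_nneseries//; last first.
  move=> n; apply/measurable_EFinP.
  by rewrite (_ : (fun w => _) = \1_(E n)); [exact: measurable_indic | apply/funext].
apply: eq_eseriesr => n _; under eq_integral do rewrite EE.
rewrite integral_indic// setIT /mean_state -sumEFin.
rewrite [LHS](measure_partition_fin (measurable_state n))//.
apply: eq_bigr => z _; rewrite EFinM lawE; case: (boolP (A z)) => Az.
  rewrite mule1; congr (P i _); apply/seteqP; split=> [w []//|w wz].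
  by split=> //; rewrite /E /mkset/= (wz : state n w = z).
rewrite mule0 -[RHS](measure0 (P i)); congr (P i _); apply/seteqP; split=> // w [Aw wz].
by move: Aw Az; rewrite /E /= (wz : state n w = z) => ->.
Qed.

(** [F] pays for each visit to [A] by its expected decrease; the sum telescopes and the remainder is
    nonnegative. *)
Lemma expected_count_le i (A : pred (G * {set G})) F :
  (forall z, 0 <= F z) -> (forall z, (A z)%:R + transition F z <= F z) ->
  (\sum_(n <oo) (mean_state i n (fun z => (A z)%:R))%:E <= (F (i, finset.set0))%:E)%E.
Proof.
move=> F0 AF.
have bnd n : \sum_(0 <= k < n) mean_state i k (fun z => (A z)%:R) + mean_state i n F
    <= F (i, finset.set0).
  elim: n => [|n IH]; first by rewrite big_geq// add0r mean_state0.
  apply: le_trans IH; rewrite big_nat_recr//= -addrA lerD2l mean_stateS -mean_stateD.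
  exact: mean_state_le.
apply: lime_le.
  by apply: is_cvg_nneseries => n _ _; rewrite lee_fin mean_state_ge0.
near=> n; rewrite sumEFin lee_fin; apply: le_trans (bnd n).
by rewrite lerDl mean_state_ge0.
Unshelve. all: by end_near. Qed.

(* The remainder [mean_state i n F] is controlled by the n-th term of the series,
   so it vanishes in the limit whenever the series converges. *)
Lemma expected_count_ge i (A : pred (G * {set G})) F (K : R) :
  (forall z, F z <= (A z)%:R + transition F z) ->
  (forall z, transition F z <= K * (A z)%:R) ->
  ((F (i, finset.set0))%:E <= \sum_(n <oo) (mean_state i n (fun z => (A z)%:R))%:E)%E.
Proof.
move=> FA AK; set q := fun n => mean_state i n (fun z => (A z)%:R).
have q0 n : 0 <= q n by rewrite mean_state_ge0.
have bnd n : F (i, finset.set0) <= \sum_(0 <= k < n) q k + mean_state i n F.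
  elim: n => [|n IH]; first by rewrite big_geq// add0r mean_state0.
  apply: le_trans IH _; rewrite big_nat_recr//= -addrA lerD2l mean_stateS -mean_stateD.
  exact: mean_state_le.
have [->|qfin] := eqVneq (\sum_(n <oo) (q n)%:E)%E +oo%E; first by rewrite leey.
have qcvg : cvgn (series q) by apply: nnseries_is_cvg => //; rewrite ltey.
have tail0 : K * q n @[n --> \oo] --> 0.
  by rewrite -(mulr0 K); apply: cvgMr; exact: cvg_series_cvg_0.
have tot : series q n.+1 + K * q n @[n --> \oo] --> limn (series q).
  rewrite -[X in _ --> X]addr0; apply: cvgD => //.
  by move: qcvg; rewrite -(cvg_shiftS (series q)).
have -> : (\sum_(n <oo) (q n)%:E)%E = (limn (series q))%:E.
  rewrite -EFin_lim//; apply: congr_lim; apply/funext => n /=.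
  by rewrite sumEFin.
rewrite lee_fin -(cvg_lim _ tot)//; apply: limr_ge; first by apply/cvg_ex; eexists; exact: tot.
near=> n; apply: le_trans (bnd n.+1) _; rewrite lerD2l mean_stateS -mean_stateZ.
exact: mean_state_le.
Unshelve. all: by end_near. Qed.

End VisitedChain.

(** * Weighted averages of affine functions *)

Lemma weighted_mean_shift {R : realType} {I : finType} (p u : I -> R) (c : R) :
  \sum_i p i = 1 -> \sum_i p i * (u i + c) = \sum_i p i * u i + c.
Proof.
move=> p1; rewrite -[X in _ + X]mul1r -p1 mulr_suml -big_split.
by apply: eq_bigr => i _; rewrite mulrDr.
Qed.

Lemma weighted_mean_affine {R : realType} {I : finType} (p u : I -> R) (a c : R) :
  \sum_i p i = 1 ->
  \sum_i p i * (u i * a + c) = (\sum_i p i * u i) * a + c.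
Proof.
move=> p1; rewrite (weighted_mean_shift (fun i => u i * a))// mulr_suml.
by congr (_ + _); apply: eq_bigr => i _; rewrite mulrA.
Qed.

(** * Expected hitting and cover times of the walk *)

Section Times.
Context {R : realType} {G : multigraph}.
Context {d : measure_display} {T : measurableType d}.
Variables (P : G -> probability T R) (X : nat -> T -> G).
Hypothesis walkX : simple_random_walk P X.

(** The current vertex is added to the set because a visit at time n itself counts as a hit by time
    n. *)
Lemma expected_hittingE i j : expected_hitting P X i j =
  (\sum_(n <oo) (mean_state P X i n (fun z => (j \notin z.1 |: z.2)%SET%:R))%:E)%E.
Proof.
apply: integral_counting_states => // w; apply: ereal_inf_nat_series => n.
rewrite /state /= -visitedS; split=> [/visitedP nj k kn /= Xk|nX].
  by apply: nj; exists k.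
by apply/visitedP => -[k kn Xk]; exact: (nX k).
Qed.

Lemma expected_coverE i : expected_cover P X i =
  (\sum_(n <oo) (mean_state P X i n (fun z => ((z.1 |: z.2)%SET != [set: G]%SET)%:R))%:E)%E.
Proof.
apply: integral_counting_states => // w; apply: ereal_inf_nat_series => n.
rewrite /state /= -visitedS; split=> [nT k kn /= cov|ncov].
  move/eqP: nT; apply; apply/finset.setP => v; rewrite finset.in_setT.
  by apply/visitedP; have [l lk Xl] := cov v; exists l; rewrite ?ltnS ?(leq_trans lk).
apply/eqP => visT; apply: (ncov n) => // v.
have /visitedP[l ln Xl] : v \in visited X n.+1 w by rewrite visT finset.in_setT.
by exists l.
Qed.

Hypotheses (connG : connected_graph G) (G_ge2 : (2 <= #|G|)%N).

Local Notation hit := (@hit R G connG G_ge2).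
Local Notation mean_hit := (@mean_hit R G connG G_ge2).

Lemma expected_hitting_le i j : (expected_hitting P X i j <= (hit j i)%:E)%E.
Proof.
rewrite expected_hittingE.
(* The remaining time is set to 0 once [j] has been left, so nothing is charged after the hit. *)
pose F (z : G * {set G}) : R := if (j \in z.2)%SET then 0 else hit j z.1.
have -> : hit j i = F (i, finset.set0) by rewrite /F finset.inE.
apply: expected_count_le => // z; first by rewrite /F; case: ifP => // _; exact: hit_ge0.
rewrite /transition /F finset.in_setU1 negb_or; case: ifPn => jz /=.
  by rewrite orbT andbF add0r big1// => v _; rewrite mulr0.
rewrite orbF andbT; have [->|jz1] /= := eqVneq j z.1.
  by rewrite add0r big1 ?hit_ge0// => v _; rewrite mulr0.
by rewrite -hit_step// eq_sym.
Qed.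

Lemma sum_stationary : \sum_(x : G) stationary R x = 1.
Proof.
rewrite /stationary -mulr_suml -natr_sum divff// gt_eqF//.
exact: total_degree_gt0.
Qed.

(** * Matthews' potential for covering a subset *)

Section CoverPotential.
Variables (S : {set G}) (k m : R).
Hypothesis commute_ge : {in S &, forall i j, i != j -> k <= hit i j + hit j i}.
Hypothesis mean_hit_ge : {in S, forall j, m <= mean_hit j}.

(* A lower bound for the expected time to cover B from v. It comes from adding
   the vertices of B in uniformly random order, as in Matthews' argument: the
   expected time to reach the j-th one when it is last among the first j is half
   a commute time plus a difference of values of [mean_hit], and these
   differences telescope. *)
Definition cover_potential (v : G) (B : {set G}) : R :=
  if B == finset.set0 then 0 else
  (\sum_(j in B) (hit j v - mean_hit j / 2)) / #|B|%:R + m / 2 +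
  k / 2 * (harmonic_sum #|B| - 1).

(** From outside [B] each [hit j] drops by 1 on average, and all other terms are independent of the
    current vertex. *)
Lemma cover_potential_step (v : G) (B : {set G}) : v \notin B -> B != finset.set0 ->
  cover_potential v B = 1 + \sum_w step_prob R v w * cover_potential w B.
Proof.
move=> vB B0; rewrite /cover_potential (negPf B0).
under [X in _ = _ + X]eq_bigr do rewrite -addrA.
rewrite weighted_mean_affine ?sum_step_prob// -addrA [in RHS]addrA; congr (_ + _).
have b0 : #|B|%:R != 0 :> R by rewrite pnatr_eq0 finset.cards_eq0.
rewrite -[X in _ = X + _](divff b0) -mulrDl; congr (_ / _).
under [X in _ = _ + X]eq_bigr do rewrite mulr_sumr.
rewrite exchange_big -sum1_card natr_sum -big_split /=; apply: eq_bigr => j jB.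
rewrite weighted_mean_shift ?sum_step_prob//.
by rewrite addrA -hit_step//; apply: contraNneq vB => ->.
Qed.

Lemma cover_potential_visit (v : G) (B : {set G}) : B \subset S -> v \in B ->
  cover_potential v B <= cover_potential v (B :\ v)%SET.
Proof.
move=> BS vB; have vS := fintype.subsetP BS v vB.
have B0 : B != finset.set0 by apply/finset.set0Pn; exists v.
rewrite /cover_potential (negPf B0) (big_setD1 v)//= hit_self sub0r.
have := cardsD1 v B; rewrite vB add1n => ->.
set B' := (B :\ v)%SET.
have [->|B'0] := eqVneq B' finset.set0.
  rewrite finset.cards0 big_set0 addr0 divr1 harmonic_sum1 subrr mulr0 addr0.
  (* For the last vertex the potential is (m - mean_hit v)/2, hence at most 0. *)
  have := mean_hit_ge vS; lra.
set s := \sum_(j in B') _; rewrite harmonic_sumS.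
(* By [hit_symm], each summand is (kappa(j,v) - mean_hit v)/2. *)
have : #|B'|%:R * ((k - mean_hit v) / 2) <= s.
  rewrite mulr_natl -sumr_const; apply: ler_sum => j /finset.setD1P[jv jB].
  have := commute_ge (fintype.subsetP BS j jB) vS jv.
  have := hit_symm (R := R) connG G_ge2 j v.
  lra.
have c0 : 0 < #|B'|%:R :> R by rewrite ltr0n card_gt0.
rewrite -(natr1 #|B'|); set c := #|B'|%:R in c0 *; set h := harmonic_sum _ => sc.
have c1 : 0 < c + 1 by lra.
rewrite -subr_ge0.
have -> : s / c + m / 2 + k / 2 * (h - 1)
    - ((- (mean_hit v / 2) + s) / (c + 1) + m / 2 + k / 2 * (h + (c + 1)^-1 - 1))
    = (s - c * ((k - mean_hit v) / 2)) / (c * (c + 1)).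
  by field; rewrite !gt_eqF.
by rewrite divr_ge0 ?mulr_ge0 ?subr_ge0// ltW.
Qed.

Lemma cover_potential_le i : ((cover_potential i S)%:E <= expected_cover P X i)%E.
Proof.
rewrite expected_coverE.
(* The current vertex still belongs to the target here; [FB] removes it before the step is taken. *)
pose F (z : G * {set G}) : R := cover_potential z.1 (S :\: z.2)%SET.
have -> : cover_potential i S = F (i, finset.set0) by rewrite /F finset.setD0.
pose K := \sum_(z : G * {set G}) `|cover_potential z.1 z.2|.
have potK v B : cover_potential v B <= K.
  by rewrite (le_trans (ler_norm _))// /K (bigD1 (v, B))//= lerDl sumr_ge0.
have FB z : F z <= cover_potential z.1 (S :\: (z.1 |: z.2))%SET.
  rewrite /F finset.setUC -finset.setDDl.
  have [zB|zB] := boolP (z.1 \in S :\: z.2)%SET; last first.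
    rewrite (_ : _ :\ _ = S :\: z.2)%SET//; apply/finset.setDidPl.
    by rewrite disjoint_sym disjoints1.
  by apply: cover_potential_visit => //; exact: finset.subsetDl.
(* While part of [S] is missing, the cover clock runs; once [S] is covered, the potential stays
   0. *)
have notcov z : (S :\: (z.1 |: z.2))%SET != finset.set0 -> (z.1 |: z.2)%SET != [set: G]%SET.
  by apply: contraNneq => ->; rewrite finset.setDT.
have pot0 v : cover_potential v finset.set0 = 0 by rewrite /cover_potential eqxx.
apply: (@expected_count_ge _ _ _ _ _ _ _ _ _ F K) => // z.
  apply: le_trans (FB z) _; rewrite /transition /F /=.
  have [->|B0] := eqVneq (S :\: (z.1 |: z.2))%SET finset.set0.
    by rewrite pot0 big1 ?addr0// => v _; rewrite pot0 mulr0.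
  rewrite (notcov _ B0) -cover_potential_step//.
  by rewrite !finset.inE eqxx.
rewrite /transition /F /=.
have [->|B0] := eqVneq (S :\: (z.1 |: z.2))%SET finset.set0.
  rewrite big1 => [|v _]; last by rewrite pot0 mulr0.
  by rewrite mulr_ge0// sumr_ge0.
rewrite (notcov _ B0) mulr1 -[leRHS]mul1r -[X in X * _](sum_step_prob connG G_ge2 z.1).
by rewrite mulr_suml; apply: ler_sum => v _; rewrite ler_wpM2l// step_prob_ge0.
Qed.

(** Under the stationary law [hit j] averages to [mean_hit j], half of which is subtracted in the
    potential. *)
Lemma mean_cover_potential : S != finset.set0 ->
  \sum_i stationary R i * cover_potential i S =
  (\sum_(j in S) mean_hit j) / 2 / #|S|%:R + m / 2 + k / 2 * (harmonic_sum #|S| - 1).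
Proof.
move=> S0; rewrite /cover_potential (negPf S0).
under eq_bigr do rewrite -addrA.
rewrite weighted_mean_affine ?sum_stationary// -addrA; congr (_ / _ + _).
under eq_bigr do rewrite mulr_sumr.
rewrite exchange_big mulr_suml /=; apply: eq_bigr => j _.
rewrite weighted_mean_shift ?sum_stationary//.
rewrite /mean_hit; lra.
Qed.

End CoverPotential.

(** * The logarithmic bound for a single set *)

Lemma matthews_ln_le (S : {set G}) (k : R) : (2 <= #|S|)%N -> 0 <= k ->
  {in S &, forall i j, i != j -> k <= hit i j + hit j i} ->
  ((k * ln #|S|%:R / 2)%:E <= stationary_cover P X)%E.
Proof.
move=> S2 k0 kS; have S0 : S != finset.set0 by rewrite -card_gt0 (leq_trans _ S2).
have /finset.set0Pn[i0 i0S] := S0.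
case: (@arg_minP _ _ _ i0 (mem S) mean_hit i0S) => l lS lmin; have {}lS : l \in S by [].
apply: (@le_trans _ _ (\sum_i stationary R i * cover_potential k (mean_hit l) i S)%:E); last first.
  rewrite -sumEFin; apply: lee_sum => i _; rewrite EFinM; apply: lee_wpmul2l.
    by rewrite lee_fin divr_ge0.
  exact: cover_potential_le.
rewrite lee_fin mean_cover_potential// (big_setD1 l)//=.
have l0 : 0 <= mean_hit l by exact: mean_hit_ge0.
have := @ln_le_harmonic_sum R #|S| (ltnW S2).
have := cardsD1 l S; rewrite lS add1n => cS.
(* Each j other than the minimizer [l] satisfies k <= 2 (mean_hit j + mean_hit l). *)
have : #|S :\ l|%SET%:R * (k / 2 - mean_hit l) <= \sum_(j in S :\ l) mean_hit j.
  rewrite mulr_natl -sumr_const; apply: ler_sum => j /finset.setD1P[jl jS].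
  have := kS _ _ jS lS jl; have := commute_le_mean_hit (R := R) connG G_ge2 j l.
  lra.
rewrite cS -(natr1 #|(S :\ l)%SET|); set c := #|_|%:R.
set s := \sum_(j in _) _; set h := harmonic_sum _; set L := ln _ => sc Lh.
have c0 : 0 <= c by rewrite ler0n.
have c1 : 0 < c + 1 by lra.
have kL : k * (L + 2^-1 + ((c + 1) * 2)^-1) <= k * h by rewrite ler_wpM2l.
(* With n = c + 1, the loss k/(2n) is exactly what the harmonic bound [kL] gains. *)
have : k * (1 / 2 - ((c + 1) * 2)^-1) <= mean_hit l + (mean_hit l + s) / (c + 1).
  rewrite -subr_ge0.
  have -> : mean_hit l + (mean_hit l + s) / (c + 1) - k * (1 / 2 - ((c + 1) * 2)^-1) =
     (s - c * (k / 2 - mean_hit l) + mean_hit l * 2) / (c + 1).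
    by field; rewrite gt_eqF.
  by apply: divr_ge0; lra.
have -> : (mean_hit l + s) / 2 / (c + 1) = (mean_hit l + s) / (c + 1) / 2.
  by rewrite mulrAC.
lra.
Qed.

End Times.

(** * Passage to the maximum over all sets *)

Theorem theorem1p4 (R : realType) (G : multigraph)
    (connG : connected_graph G) (G_ge2 : (2 <= #|G|)%N)
    (d : measure_display) (T : measurableType d)
    (P : G -> probability T R) (X : nat -> T -> G)
    (walkX : simple_random_walk P X) :
  ((2^-1)%:E * matthews_max P X <= stationary_cover P X)%E.
Proof.
have hit0 i j : (0 <= expected_hitting P X i j)%E.
  apply: integral_ge0 => w _; apply: le_ereal_inf_tmp => _ [n _ <-].
  by rewrite lee_fin.
rewrite muleC lee_pdivrMr//; apply/bigmax_leP; split; first exact: leNye.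
move=> S S2; rewrite -lee_pdivrMr//.
have min0 : (0 <= min_commute P X S)%E.
  apply/bigmin_geP; split=> // i _; apply/bigmin_geP; split=> // j _.
  exact: adde_ge0.
have min_le i j : i \in S -> j \in S -> i != j ->
    (min_commute P X S <= (hit connG G_ge2 i j + hit connG G_ge2 j i)%:E)%E.
  move=> iS jS ij; apply: (bigmin_inf i) => //; apply: (bigmin_inf j); first exact/andP.
  (* The swap is due to [hit] taking its target first. *)
  by rewrite addrC EFinD leeD// expected_hitting_le.
(* Two distinct vertices of [S] rule out the default +oo of the minimum. *)
have minfin : min_commute P X S \is a fin_num.
  have /card_gt1P[i [j [iS jS ij]]] := S2.
  by rewrite ge0_fin_numE//; exact: le_lt_trans (min_le i j iS jS ij) (ltry _).
rewrite -(fineK minfin) -!EFinM; apply: (@matthews_ln_le _ _ _ _ _ _ walkX connG G_ge2) => //.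
  exact: fine_ge0.
by move=> i j iS jS ij; rewrite -lee_fin fineK// min_le.
Qed.
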